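(* Let $\Sigma$ be a finite alphabet and let $\mathcal{G},\widetilde{\mathcal{G}}\in\mathrm{pc}(\Sigma)$. Suppose that $\mathcal{F}=\bigcup_{n\in\mathbb{N}_{>0}}\mathcal{F}_n$ is a class of dynamics consisting of continuous invertible maps. If the transitive composition lift $(\mathcal{G}^{\circ})^+$ simulates $\widetilde{\mathcal{G}}$, then $\mathcal{G}\leq_{\mathcal{V},\mathcal{F}}\widetilde{\mathcal{G}}$ for any template $\mathcal{V}$ closed under forward composition with $\mathcal{F}$.
   Context: A labeled digraph $\mathcal{G}=(S,E)$ on a finite alphabet $\Sigma$ has a finite set of nodes $S$ and a set of labeled edges $E\subseteq S\times S\times\Sigma$. It is path-complete, written $\mathcal{G}\in\mathrm{pc}(\Sigma)$, if for every finite word $i_1i_2\cdots i_k\in\Sigma^k$ there are nodes $s_1,\dots,s_{k+1}\in S$ with $(s_j,s_{j+1},i_j)\in E$ for all $j\in\{1,\dots,k\}$. Forward composition lift: for $T\in\mathbb{N}_{>0}$, $\mathcal{G}^{\circ T}=(S^{\circ T},E^{\circ T})$ has nodes $S^{\circ T}=\{(s,j_1,\dots,j_T)\,|\,s\in S,\ (j_1,\dots,j_T)\in\Sigma^T\}$ and edges $$E^{\circ T}=\{((a,j_1,\dots,j_T),(b,i,j_1,\dots,j_{T-1}),j_T)\,|\,(a,b,i)\in E,\ (j_1,\dots,j_T)\in\Sigma^T\}.$$ Set $\mathcal{G}^{\circ 0}=\mathcal{G}$; then $\mathcal{G}^{\circ}=(S^\circ,E^\circ)=\bigcup_{T\in\mathbb{N}_{\geq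 0}}\mathcal{G}^{\circ T}$. The node $(s,j_1,\dots,j_T)$ represents the function $V_{(s,j_1,\dots,j_T)}=V_s\circ f_{j_1}\circ\cdots\circ f_{j_T}$, and an edge $(p,q,k)$ represents the inequality $V_p(x)\geq V_q(f_k(x))$ for all $x$. Transitive composition lift $(\mathcal{G}^{\circ})^+$: for a node $q=(s,i_1,\dots,i_T)\in S^\circ$ and $k\in\Sigma$ write $qk=(s,i_1,\dots,i_T,k)\in S^\circ$ (identifying the expression $V_q(f_k(x))$ with $V_{qk}(x)$). Let $\sqsupseteq$ be the smallest reflexive and transitive relation on $S^\circ$ such that $p\sqsupseteq qk$ for every edge $(p,q,k)\in E^\circ$. Then $(\mathcal{G}^{\circ})^+$ is the labeled digraph with node set $S^\circ$ and edges all triples $(p,q,k)\in S^\circ\times S^\circ\times\Sigma$ with $p\sqsupseteq qk$. (In particular, the equality $V_{(a,i)}(x)=V_a(f_i(x))$ gives the edge $((a,i),a,i)$.) A (possibly infinite) labeled digraph $(S_1,E_1)$ simulates $(S_2,E_2)$ if there is a map $R:S_2\to S_1$ such that $(a,b,i)\in E_2$ implies $(R(a),R(b),i)\in E_1$. $\mathrm{Lyap}_0(\mathbb{R}^n)$ is the set of $V\in C^0(\mathbb{R}^n;\mathbb{R}_{\geq 0})$ with $V(0)=0$, $V(x)>0$ for $x\neq 0$, and $\alpha_1(\|x\|_2)\leq V(x)\leq\alpha_2(\|x\|_2)$ for all $x$, for some class-$\mathcal{K}_\infty$ functions $\alpha_1,\alpha_2$. A class of dynamics is a family $\mathcal{F}=\bigcup_{n\in\mathbb{N}_{>0}}\mathcal{F}_n$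 with $\mathcal{F}_n\subseteq C^0(\mathbb{R}^n;\mathbb{R}^n)$, all maps $f$ satisfying $f(0)=0$. A template is a family $\mathcal{V}=\bigcup_{n\in\mathbb{N}_{>0}}\mathcal{V}_n$ with $\mathcal{V}_n$ a set of real-valued functions on $\mathbb{R}^n$. It is closed under forward composition with $\mathcal{F}$ if for all $n$, $V\in\mathcal{V}_n$ implies $V\circ f\in\mathcal{V}_n$ for all $f\in\mathcal{F}_n$. $\mathcal{G}_1\leq_{\mathcal{V},\mathcal{F}}\mathcal{G}_2$, for path-complete $\mathcal{G}_1=(S_1,E_1)$ and $\mathcal{G}_2=(S_2,E_2)$ on $\Sigma$, means: for every $n\in\mathbb{N}_{>0}$ and every family $\{f_i\,|\,i\in\Sigma\}\subseteq\mathcal{F}_n$, if there exist $V_s\in\mathcal{V}_n\cap\mathrm{Lyap}_0(\mathbb{R}^n)$, $s\in S_1$, with $V_a(x)\geq V_b(f_i(x))$ for all $x\in\mathbb{R}^n$ and all $(a,b,i)\in E_1$, then there exist $W_s\in\mathcal{V}_n\cap\mathrm{Lyap}_0(\mathbb{R}^n)$, $s\in S_2$, with $W_a(x)\geq W_b(f_i(x))$ for all $x\in\mathbb{R}^n$ and all $(a,b,i)\in E_2$. *)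

(* Defs.v *)
From HB Require Import structures.
From Stdlib Require Import Relation_Operators.
From mathcomp Require Import all_boot all_order all_algebra.
From mathcomp Require Import all_classical all_reals all_analysis.

Set Implicit Arguments.
Unset Strict Implicit.
Unset Printing Implicit Defensive.

Import Order.TTheory GRing.Theory Num.Theory.
Import numFieldNormedType.Exports.

Local Open Scope classical_set_scope.
Local Open Scope ring_scope.

(* Labeled digraphs on the alphabet Sigma, possibly infinite: the lifts below
   have infinitely many nodes. *)
Record ldigraph (Sigma : Type) := LDigraph {
  node : Type;
  edge : node -> node -> Sigma -> Prop
}.

Record fin_ldigraph (Sigma : finType) := FinLDigraph {
  fnode : finType;
  fedges : {set fnode * fnode * Sigma}
}.

Definition ldigraph_of_fin (Sigma : finType) (G : fin_ldigraph Sigma) :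
    ldigraph Sigma :=
  @LDigraph Sigma (fnode G) (fun a b i => (a, b, i) \in fedges G).

Coercion ldigraph_of_fin : fin_ldigraph >-> ldigraph.

Definition path_complete (Sigma : finType) (G : fin_ldigraph Sigma) : Prop :=
  forall (k : nat) (w : k.-tuple Sigma),
    exists s : k.+1.-tuple (fnode G), forall j : 'I_k,
      (tnth s (widen_ord (leqnSn k) j), tnth s (lift ord0 j), tnth w j)
        \in fedges G.

(* (s, [:: j_1; ...; j_T]) stands for (s, j_1, ..., j_T); the words of length T
   give the nodes of the T-th lift, so that this type is the disjoint union of
   the node sets over all T, with s identified to (s, [::]). *)
Definition lift_node (Sigma : Type) (G : ldigraph Sigma) : Type :=
  (node G * seq Sigma)%type.

(* For T > 0 the word (j_1, ..., j_T) is written rcons w j, where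
   w = (j_1, ..., j_(T-1)) and j = j_T. *)
Inductive forward_lift_edge (Sigma : Type) (G : ldigraph Sigma) :
    nat -> lift_node G -> lift_node G -> Sigma -> Prop :=
| ForwardLift0 (a b : node G) (i : Sigma) :
    edge a b i -> forward_lift_edge 0 (a, [::]) (b, [::]) i
| ForwardLiftS (T : nat) (a b : node G) (i : Sigma) (w : seq Sigma)
    (j : Sigma) :
    edge a b i -> size w = T ->
    forward_lift_edge T.+1 (a, rcons w j) (b, i :: w) j.

Definition composition_lift (Sigma : Type) (G : ldigraph Sigma) :
    ldigraph Sigma :=
  @LDigraph Sigma (lift_node G)
    (fun p q k => exists T : nat, forward_lift_edge T p q k).

Definition node_rcons (Sigma : Type) (G : ldigraph Sigma)
    (q : node (composition_lift G)) (k : Sigma) : node (composition_lift G) :=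
  (q.1, rcons q.2 k).

Definition lift_geq (Sigma : Type) (G : ldigraph Sigma) :
    node (composition_lift G) -> node (composition_lift G) -> Prop :=
  clos_refl_trans (node (composition_lift G))
    (fun p r => exists (q : node (composition_lift G)) (k : Sigma),
       edge p q k /\ r = node_rcons q k).

Definition transitive_composition_lift (Sigma : Type) (G : ldigraph Sigma) :
    ldigraph Sigma :=
  @LDigraph Sigma (node (composition_lift G))
    (fun p q k => lift_geq p (node_rcons q k)).

Definition simulates (Sigma : Type) (G1 G2 : ldigraph Sigma) : Prop :=
  exists r : node G2 -> node G1,
    forall (a b : node G2) (i : Sigma), edge a b i -> edge (r a) (r b) i.

(* The library norm on 'rV[R]_n is the sup norm, which induces the same
   topology. *)
Definition norm_2 (R : realType) (n : nat) (x : 'rV[R]_n) : R :=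
  Num.sqrt (\sum_(i < n) x ord0 i ^+ 2).

(* Class-K_infinity functions are defined on [0, +oo[; the values of alpha on
   negative reals are irrelevant. *)
Definition class_Kinfty (R : realType) (alpha : R -> R) : Prop :=
  [/\ {within `[0, +oo[, continuous alpha},
      alpha 0 = 0,
      forall s t : R, 0 <= s -> s < t -> alpha s < alpha t
    & alpha x @[x --> +oo] --> +oo].

Definition Lyap0 (R : realType) (n : nat) : set ('rV[R]_n -> R) :=
  [set V | [/\ continuous (V : 'rV[R]_n -> R),
               forall x : 'rV[R]_n, 0 <= V x,
               V 0 = 0,
               forall x : 'rV[R]_n, x != 0 -> 0 < V x
             & exists alpha1 alpha2 : R -> R,
                 [/\ class_Kinfty alpha1, class_Kinfty alpha2
                   & forall x : 'rV[R]_n,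
                       alpha1 (norm_2 x) <= V x <= alpha2 (norm_2 x)]]].

(* Families indexed by the dimension n; only the members with n > 0 are ever
   used. *)
Definition dynamics_family (R : realType) : Type :=
  forall n : nat, set ('rV[R]_n -> 'rV[R]_n).

Definition template (R : realType) : Type :=
  forall n : nat, set ('rV[R]_n -> R).

Definition class_of_dynamics (R : realType) (F : dynamics_family R) : Prop :=
  forall n : nat, (0 < n)%N -> forall f, F n f -> continuous f /\ f 0 = 0.

Definition invertible_dynamics (R : realType) (F : dynamics_family R) : Prop :=
  forall n : nat, (0 < n)%N -> forall f, F n f -> bijective f.

Definition closed_under_forward_composition (R : realType)
    (V : template R) (F : dynamics_family R) : Prop :=
  forall n : nat, (0 < n)%N ->
    forall v, V n v -> forall f, F n f -> V n (v \o f).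

Definition admits_certificate (R : realType) (V : template R)
    (Sigma : finType) (G : fin_ldigraph Sigma) (n : nat)
    (f : Sigma -> 'rV[R]_n -> 'rV[R]_n) : Prop :=
  exists v : fnode G -> 'rV[R]_n -> R,
    (forall s, (V n `&` @Lyap0 R n) (v s)) /\
    (forall (a b : fnode G) (i : Sigma), (a, b, i) \in fedges G ->
       forall x, v b (f i x) <= v a x).

Definition certificate_le (R : realType) (V : template R)
    (F : dynamics_family R) (Sigma : finType) (G1 G2 : fin_ldigraph Sigma) :
    Prop :=
  forall n : nat, (0 < n)%N ->
    forall f : Sigma -> 'rV[R]_n -> 'rV[R]_n, (forall i, F n (f i)) ->
      admits_certificate V G1 f -> admits_certificate V G2 f.

(* Main.v *)
Require Import Defs.
From mathcomp Require Import all_boot all_order all_algebra all_fingroup.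
From mathcomp Require Import all_classical all_reals all_analysis.
From mathcomp Require Import zify ring lra.

Set Implicit Arguments.
Unset Strict Implicit.
Unset Printing Implicit Defensive.

Import Order.TTheory GRing.Theory Num.Theory.
Import numFieldNormedType.Exports.

(** The certificate on the target graph is read off the simulation: a node sent
    to (s, w) receives V_s composed with the maps of the word w
    ([node_function]).  Every edge of the lift is an instance of an inequality
    of the original certificate, evaluated at a shifted point, so the order on
    lifted nodes is sound for these functions ([lift_geq_node_function]), and
    closure of the template puts them in the template.

    What remains is that V \o f is again in Lyap_0 when V is and f is a
    continuous bijection fixing the origin ([Lyap0_comp]).  The two comparison
    functions come from explicit formulas once V \o f is continuous, positive
    definite and radially unbounded ([Lyap0_of_radially_unbounded]).  Radial
    unboundedness is the real difficulty: it says that f is proper, and since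
    only the bijectivity of f is assumed this is invariance of domain for
    bijections of R^n ([continuous_inverse], [continuous_bijection_proper]).

    Invariance of domain is proved in the spirit of Kulpa.  If f 0 were not
    interior to the image K of the unit cube, some c close to f 0 would lie
    outside K.  Approximate the inverse of f on K by a Lipschitz map P defined
    everywhere ([lipschitz_approx_inverse]), and push K radially off the cube of
    radius eps about c ([push_out]).  A small translate P + v does not vanish on
    the surface of that cube, because the Lipschitz image of a set of dimension
    n - 1 cannot cover a cube of dimension n ([lipschitz_sphere_avoid]); nor does
    it vanish on the rest of K, because its zeros on K lie close to f 0.  Hence
    x |-> P (push_out (f x)) + v has no zero on the unit cube, although on the
    faces it has the signs of x; this contradicts the Poincare-Miranda theorem
    ([poincare_miranda]).  The latter follows by compactness from a parity
    argument of Sperner type for the Kuhn triangulation of a grid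
    ([sperner_cube]). *)

(** * A Sperner lemma for the Kuhn triangulation of a cube *)

(** Elements moved by an involution come in pairs. *)
Lemma odd_card_fixed (T : finType) (g : T -> T) (A : {set T}) :
  {in A, forall x, g x \in A} -> {in A, forall x, g (g x) = x} ->
  odd #|A| = odd #|[set x in A | g x == x]|.
Proof.
have [n] := ubnP #|A|; elim: n A => // n IH A; rewrite ltnS => leA stA invA.
have [/existsP[x /andP[xA gx]]|/existsPn fixA] :=
    boolP [exists x, (x \in A) && (g x != x)]; last first.
  congr (odd #|pred_of_set _|); apply/setP => x; rewrite inE.
  by have := fixA x; case: (x \in A) => //=; rewrite negbK => ->.
have gxA := stA _ xA.
have cA : #|A| = #|A :\ x :\ g x|.+2.
  by rewrite (cardsD1 x) xA (cardsD1 (g x)) !inE gx gxA.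
have -> : [set y in A | g y == y] = [set y in A :\ x :\ g x | g y == y].
  apply/setP => y; rewrite !inE; case: (eqVneq y (g x)) => [->|ygx] /=.
    by rewrite invA // [x == _]eq_sym (negbTE gx) andbF.
  by case: (eqVneq y x) => [->|//] /=; rewrite (negbTE gx) andbF.
rewrite cA /= negbK; apply: IH.
- by rewrite cA in leA; lia.
- move=> y; rewrite !inE => /and3P[ygx yx yA]; rewrite stA // andbT.
  apply/andP; split; last by apply: contraNneq ygx => <-; rewrite invA.
  by apply: contraNneq yx => E; rewrite -(invA _ yA) E invA.
- by move=> y; rewrite !inE => /and3P[_ _ /invA].
Qed.

(** A door is a facet whose vertices carry exactly the labels below n.  A simplex
    carrying all labels has one door, opposite to its vertex labelled n.  One
    carrying just the labels below n has a single repeated label, and two doors,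
    opposite to the two vertices that share it.  Any other simplex has none. *)
Lemma odd_card_doors n (a : 'I_n.+1 -> nat) : (forall k, a k <= n) ->
  odd #|[set k | [forall l : 'I_n, [exists j, (j != k) && (a j == l)]]]| =
  [forall l : 'I_n.+1, [exists j, a j == l]].
Proof.
move=> an; set D := [set k | _].
pose b k : 'I_n.+1 := Ordinal (an k : a k < n.+1).
have [onto|not_onto] := boolP [forall l : 'I_n, [exists j, a j == l]]; last first.
  have -> : D = finset.set0.
    apply/setP => k; rewrite !inE; apply: contraNF not_onto => /forallP h.
    by apply/forallP => l; have /existsP[j /andP[_ ?]] := h l; apply/existsP; exists j.
  rewrite cards0; apply/esym; apply: contraNF not_onto => /forallP h.
  by apply/forallP => l; exact: h (widen_ord (leqnSn n) l).
have ontoP (l : nat) : l < n -> exists j, a j = l.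
  by move=> ln; have /existsP[j /eqP ?] := forallP onto (Ordinal ln); exists j.
have [/injectiveP binj|/injectivePn[k1 [k2 k12 bk]]] := boolP (injectiveb b).
  have bsurj (l : 'I_n.+1) : exists j, b j = l.
    by have [g _ gK] := injF_bij binj; exists (g l).
  have -> : [forall l : 'I_n.+1, [exists j, a j == l]].
    by apply/forallP => l; have [j <-] := bsurj l; apply/existsP; exists j.
  (* The only door is opposite to the vertex labelled n. *)
  have [k0 k0E] := bsurj ord_max.
  have -> : D = [set k0].
    apply/setP => k; rewrite !inE; apply/forallP/eqP => [h|-> l].
      apply: (binj); rewrite k0E; apply/val_inj/eqP; rewrite /= eqn_leq an /= leqNgt.
      apply/negP => akn; have /existsP[j /andP[/eqP jk /eqP aj]] := h (Ordinal akn).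
      by apply: jk; apply: binj; apply/val_inj.
    have [j aj] := ontoP l (ltn_ord l); apply/existsP; exists j; rewrite aj eqxx andbT.
    apply: contra_eq_neq k0E => jk; rewrite -jk -val_eqE /= aj.
    by have := ltn_ord l; lia.
  by rewrite cards1.
have k21 : k2 != k1 by rewrite eq_sym.
have a12 : a k1 = a k2 by have /(congr1 val) := bk.
have card_ge m (A : {set 'I_n.+1}) :
    (forall l, l < m -> exists2 j, j \in A & a j = l) -> m <= #|A|.
  move=> h; have h' (l : 'I_m) : {j | (j \in A) && (a j == l)}.
    by apply: sigW; have [j jA aj] := h l (ltn_ord l); exists j; rewrite jA aj eqxx.
  pose f l := sval (h' l).
  have fA l : f l \in A by rewrite /f; case: (h' l) => j /= /andP[].
  have fl l : a (f l) = l by rewrite /f; case: (h' l) => j /= /andP[_ /eqP].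
  have injf : injective f by move=> l l' /(congr1 a); rewrite !fl => /val_inj.
  rewrite -[m]card_ord -(card_imset _ injf); apply: subset_leq_card.
  by apply/fintype.subsetP => _ /imsetP[l _ ->].
(* A vertex labelled like k1 can be replaced by k2. *)
have avoid m (k : 'I_n.+1) : k != k2 ->
    (forall l, l < m -> exists2 j, j != k & a j = l) ->
    (forall l, l < m -> exists2 j, j \in [set~ k] :\ k1 & a j = l).
  move=> kk2 h l /h[j jk aj]; have [jk1|jk1] := eqVneq j k1.
    by exists k2; rewrite ?inE ?k21 1?[k2 == k]eq_sym // -a12 -jk1.
  by exists j => //; rewrite !inE jk jk1.
have -> : [forall l : 'I_n.+1, [exists j, a j == l]] = false.
  apply/negP => /forallP h.
  suff : n.+1 <= #|[set~ k1]| by rewrite cardsC1 card_ord ltnn.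
  apply: card_ge => l ln; have /existsP[j /eqP aj] := h (Ordinal ln).
  have [jk1|jk1] := eqVneq j k1; last by exists j; rewrite ?inE.
  by exists k2; rewrite ?inE // -a12 -jk1.
have -> : D = [set k1; k2].
  apply/setP => k; rewrite !inE; apply/forallP/orP => [h|kE l]; last first.
    have [j aj] := ontoP l (ltn_ord l); apply/existsP.
    have [jk|jk] := eqVneq j k; last by exists j; rewrite jk aj eqxx.
    case: kE => /eqP kE; [exists k2|exists k1]; rewrite kE ?k21 ?k12 /=.
      by rewrite -a12 -kE -jk aj.
    by rewrite a12 -kE -jk aj.
  have [|kk1] := eqVneq k k1; first by left.
  have [|kk2] := eqVneq k k2; first by right.
  suff : n <= #|[set~ k] :\ k1|.
    have := cardsD1 k1 [set~ k].
    by rewrite cardsC1 card_ord !inE [k1 == k]eq_sym kk1 /=; lia.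
  apply: card_ge; apply: avoid => // l ln.
  by have /existsP[j /andP[jk /eqP aj]] := h (Ordinal ln); exists j.
by rewrite cards2 k12.
Qed.

(* A simplex of the Kuhn triangulation: its lowest vertex v, and the permutation
   giving the rank s i at which coordinate i is raised along the chain of
   vertices. *)
Notation kuhn_cell n N := ({ffun 'I_n -> 'I_N} * {perm 'I_n})%type.

Section Kuhn.
Variables (n N : nat).

Definition kuhn_vertex (c : kuhn_cell n N) (k : nat) :
  {ffun 'I_n -> nat} := [ffun i => c.1 i + (c.2 i < k)].

Lemma kuhn_vertex_le c k i : kuhn_vertex c k i <= N.
Proof.
rewrite ffunE; have := ltn_ord (c.1 i).
by case: (_ < k); rewrite ?addn1 ?addn0 // => /ltnW.
Qed.

Definition fully_labelled (lab : {ffun 'I_n -> nat} -> nat)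
    (c : kuhn_cell n N) : bool :=
  [forall l : 'I_n.+1, exists j : 'I_n.+1, lab (kuhn_vertex c j) == l].

(** A pair (simplex, k) stands for the facet opposite to vertex k. *)
Definition door (lab : {ffun 'I_n -> nat} -> nat)
    (x : kuhn_cell n N * 'I_n.+1) : bool :=
  [forall l : 'I_n, exists j : 'I_n.+1,
     (j != x.2) && (lab (kuhn_vertex x.1 j) == l)].

End Kuhn.

(** Count doors simplex by simplex, modulo 2. *)
Lemma odd_card_fully_labelled n N (lab : {ffun 'I_n -> nat} -> nat) :
  (forall p : {ffun 'I_n -> nat}, (forall i, p i <= N) -> lab p <= n) ->
  odd #|[set c | @fully_labelled n N lab c]| = odd #|[set x | @door n N lab x]|.
Proof.
move=> labn.
have -> : #|[set x | @door n N lab x]| =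
  \sum_(c : kuhn_cell n N) #|[set k | door lab (c, k)]|.
  rewrite -sum1_card (eq_bigl (fun x => true && door lab (x.1, x.2))); last first.
    by move=> [c k]; rewrite inE.
  rewrite -(pair_big_dep xpredT (fun c k => door lab (c, k)) (fun _ _ => 1)) /=.
  by apply: eq_bigr => c _; rewrite -sum1_card; apply: eq_bigl => k; rewrite inE.
rewrite -sum1_card big_mkcond /= !(big_morph odd oddD (erefl _)).
apply: eq_bigr => c _; rewrite inE.
have -> : odd #|[set k | door lab (c, k)]| = fully_labelled lab c.
  apply: (@odd_card_doors n (fun k => lab (kuhn_vertex c k))) => k.
  by apply: labn => i; exact: kuhn_vertex_le.
by case: fully_labelled.
Qed.

Lemma ltn_ord_neq_max n (k : 'I_n.+1) : k != ord_max -> k < n.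
Proof. by move=> km; rewrite ltn_neqAle -ltnS ltn_ord andbT. Qed.

Section Facet.
Variables (n N : nat).
Implicit Types (v : {ffun 'I_n.+1 -> 'I_N.+1}) (s : {perm 'I_n.+1}).

Definition ord_pred_perm : {perm 'I_n.+1} := perm (@ord_pred_inj n.+1).

Definition shift_up v i : {ffun 'I_n.+1 -> 'I_N.+1} :=
  [ffun j => if j == i then inord (v j).+1 else v j].
Definition shift_down v i : {ffun 'I_n.+1 -> 'I_N.+1} :=
  [ffun j => if j == i then inord (v j).-1 else v j].

(** The same facet seen from the simplex on its other side, or unchanged if it
    lies on the boundary of the grid.  Opposite to an inner vertex k, the
    neighbour raises the coordinates of ranks k - 1 and k in the other order;
    opposite to the first (last) vertex, the chain is prolonged at its other end
    by raising (lowering) the coordinate that was dropped. *)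
Definition across_facet
    (x : kuhn_cell n.+1 N.+1 * 'I_n.+2) :=
  let: (v, s, k) := x in
  if k == ord0 then
    let i := s^-1%g ord0 in
    if v i < N then (shift_up v i, (s * ord_pred_perm)%g, ord_max) else x
  else if k == ord_max then
    let i := s^-1%g ord_max in
    if 0 < v i then (shift_down v i, (s * ord_pred_perm^-1)%g, ord0) else x
  else (v, (s * tperm (inord k.-1) (inord k))%g, k).

Lemma ord_pred_perm0 : ord_pred_perm ord0 = ord_max.
Proof. by apply/val_inj; rewrite permE /= modn_small. Qed.

Lemma ord_pred_permV_max : (ord_pred_perm^-1)%g ord_max = ord0.
Proof. by rewrite -ord_pred_perm0 permK. Qed.

Lemma across_facetK : involutive across_facet.
Proof.
move=> [[v s] k] /=; case: (eqVneq k ord0) => [->|k0].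
  case: ifPn => vi /=; last by rewrite ?eqxx ?(negbTE vi).
  rewrite eqxx /= invMg permM ord_pred_permV_max ffunE eqxx inordK // ltnS.
  rewrite /= -mulgA mulgV mulg1; congr (_, _, _).
  apply/ffunP => j; rewrite !ffunE; case: eqVneq => // ->.
  by apply/val_inj; rewrite /= !inordK //=.
case: (eqVneq k ord_max) => [->|km] /=; last first.
  by rewrite (negbTE k0) (negbTE km) -mulgA tperm2 mulg1.
case: ifPn => vi /=; last by rewrite (negbTE vi) eqxx.
rewrite invMg invgK permM ord_pred_perm0 ffunE eqxx.
have vN : (v (s^-1%g ord_max)).-1 < N.
  by have := ltn_ord (v (s^-1%g ord_max)); move: vi; case: (nat_of_ord (v _)).
rewrite inordK ?vN; last exact: ltnW.
rewrite -mulgA mulVg mulg1; congr (_, _, _).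
apply/ffunP => j; rewrite !ffunE; case: eqVneq => // ->.
apply/val_inj; rewrite /= [X in (inord X.+1)]inordK ?prednK //; last exact: ltnW.
by rewrite inord_val.
Qed.

Lemma ord_pred_permE (i : 'I_n.+1) : i != ord0 -> ord_pred_perm i = i.-1 :> nat.
Proof.
rewrite -val_eqE /= permE /=; have := ltn_ord i; case: (nat_of_ord i) => // m mn _.
by rewrite addSn /= modnDr modn_small // ltnW.
Qed.

Lemma ord_pred_permVE (i : 'I_n.+1) :
  i != ord_max -> (ord_pred_perm^-1)%g i = i.+1 :> nat.
Proof.
move=> im; have -> : i = ord_pred_perm (ordS i).
  by apply/val_inj; rewrite permE ordSK.
rewrite permK ord_pred_permE /=.
  have in1 : i.+1 < n.+1.
    by move: im; rewrite -val_eqE /= ltnS ltn_neqAle -ltnS ltn_ord andbT.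
  by rewrite modn_small.
apply: contraNneq im => /(congr1 ord_pred_perm); rewrite ord_pred_perm0 => <-.
by rewrite permE ordSK.
Qed.

Lemma kuhn_vertex_across_facet x (j : 'I_n.+2) : j != x.2 ->
  exists2 j' : 'I_n.+2, j' != (across_facet x).2 &
    kuhn_vertex x.1 j = kuhn_vertex (across_facet x).1 j'.
Proof.
case: x => [[v s] k] /= jk; case: (eqVneq k ord0) jk => [-> j0|k0 jk].
  case: ifPn => vi /=; last by exists j.
  have jgt0 : 0 < j by rewrite lt0n.
  have jn : j.-1 < n.+1 by have := ltn_ord j; case: (nat_of_ord j) jgt0.
  exists (widen_ord (leqnSn _) (Ordinal jn)).
    by rewrite -val_eqE /= neq_ltn jn.
  apply/ffunP => i; rewrite !ffunE /= permM.
  case: eqVneq => [->|ii].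
    rewrite permKV ord_pred_perm0 /= inordK // jgt0 addn1 [n < _]ltnNge.
    by rewrite -ltnS jn addn0.
  have si0 : s i != ord0 by apply: contraNneq ii => <-; rewrite permK.
  rewrite ord_pred_permE //; congr (_ + nat_of_bool _).
  by rewrite -[in LHS](prednK jgt0) ltnS -[in RHS]ltnS prednK // lt0n.
case: (eqVneq k ord_max) jk => [-> jm|km jk] /=.
  case: ifPn => vi /=; last by exists j.
  have jn : j < n.+1 by rewrite ltn_neqAle -ltnS ltn_ord andbT.
  exists (lift ord0 (Ordinal jn)) => //.
  apply/ffunP => i; rewrite !ffunE /= permM.
  case: eqVneq => [->|ii].
    rewrite permKV ord_pred_permV_max /= inordK ?prednK //; last exact: ltnW.
    by rewrite addn1 prednK // [n < _]ltnNge -ltnS jn addn0.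
  rewrite ord_pred_permVE //.
  by apply: contraNneq ii => <-; rewrite permK.
exists j => //; apply/ffunP => i; rewrite !ffunE /= permM; congr (_ + nat_of_bool _).
have kn : k < n.+1 by exact: ltn_ord_neq_max.
have threshold : (@inord n k.-1 < j) = (@inord n k < j).
  have k1 : 0 < k by rewrite lt0n.
  have kp : k.-1 < n.+1 by exact: leq_ltn_trans (leq_pred k) kn.
  rewrite !inordK // prednK // leq_eqVlt.
  by rewrite val_eqE eq_sym (negbTE jk).
by case: tpermP => // ->.
Qed.

Lemma door_across_facet (lab : {ffun 'I_n.+1 -> nat} -> nat) x :
  door lab x -> door lab (across_facet x).
Proof.
move=> /forallP dx; apply/forallP => l.
have /existsP[j /andP[jx /eqP <-]] := dx l.
have [j' j'x ->] := kuhn_vertex_across_facet jx.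
by apply/existsP; exists j'; rewrite j'x eqxx.
Qed.

(** On a face x_i = N + 1 label i is missing.  On a face x_i = 0 all labels are at
    most i, so that the greatest label of a door is missing unless i is the last
    index.  Boundary doors thus lie on the face where the last coordinate
    vanishes. *)
Lemma door_fixed (lab : {ffun 'I_n.+1 -> nat} -> nat) x :
  (forall p : {ffun 'I_n.+1 -> nat}, (forall i, p i <= N.+1) ->
     forall i, p i = 0 -> lab p <= i) ->
  (forall p : {ffun 'I_n.+1 -> nat}, (forall i, p i <= N.+1) ->
     forall i, p i = N.+1 -> lab p <> i) ->
  door lab x -> across_facet x = x ->
  [/\ x.2 = ord_max, x.1.2 ord_max = ord_max & x.1.1 ord_max = ord0].
Proof.
case: x => [[v s] k] lab0 labN dx.
have box j i : kuhn_vertex (v, s) j i <= N.+1 by exact: kuhn_vertex_le.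
rewrite /across_facet; case: eqVneq => [k0|k0].
  case: ifPn => vi; first by move/(congr1 snd); rewrite k0.
  case/existsP: (forallP dx (s^-1%g ord0)) => j /andP[/= jk /eqP E] _.
  case: (labN _ (box j) _ _ E); rewrite ffunE /= permKV.
  have -> : v (s^-1%g ord0) = N :> nat.
    by apply/eqP; rewrite eqn_leq -ltnS ltn_ord leqNgt.
  by rewrite lt0n; move: jk; rewrite k0 -val_eqE /= => ->; rewrite addn1.
case: eqVneq => [km|km]; last first.
  move=> [/(congr1 (fun t : {perm 'I_n.+1} => t (s^-1%g (inord k))))].
  rewrite permM permKV tpermR => /(congr1 val) /=.
  have kn : k < n.+1 by exact: ltn_ord_neq_max.
  have k1 : 0 < k by rewrite lt0n.
  have kp : k.-1 < n.+1 by exact: leq_ltn_trans (leq_pred k) kn.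
  by rewrite !inordK //; lia.
case: ifPn => vi; first by move/(congr1 snd); rewrite /= km.
move=> _; set i := s^-1%g ord_max in vi *.
have i_max : i = ord_max.
  case/existsP: (forallP dx ord_max) => j /andP[/= jk /eqP E].
  have : lab (kuhn_vertex (v, s) j) <= i.
    apply: lab0 => //; rewrite ffunE /= /i permKV /=.
    move: vi jk; rewrite lt0n negbK => /eqP ->.
    by rewrite km -val_eqE /= ltnNge; have := ltn_ord j; lia.
  by rewrite E /= => ni; apply/val_inj => /=; have := ltn_ord i; lia.
split=> //=; first by rewrite -[X in s X]i_max /i permKV.
by apply/val_inj => /=; move: vi; rewrite -i_max; case: (nat_of_ord (v i)).
Qed.

End Facet.

(* The face where the last coordinate vanishes is a grid of one dimension less,
   whose Kuhn simplices are the facets found in the previous lemma. *)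
Section Restriction.
Variable n : nat.

Definition extend0 (T : Type) (z : T) (p : {ffun 'I_n -> T}) : {ffun 'I_n.+1 -> T} :=
  [ffun i => if unlift ord_max i is Some j then p j else z].

Lemma extend0_lift T z (p : {ffun 'I_n -> T}) i : extend0 z p (lift ord_max i) = p i.
Proof. by rewrite ffunE liftK. Qed.

Lemma extend0_max T z (p : {ffun 'I_n -> T}) : extend0 z p ord_max = z.
Proof. by rewrite ffunE unlift_none. Qed.

Definition facet_of_cell N (c : kuhn_cell n N.+1) :
    kuhn_cell n.+1 N.+1 * 'I_n.+2 :=
  (extend0 ord0 c.1, lift_perm ord_max ord_max c.2, ord_max).

Lemma lift_perm_inj (i j : 'I_n.+1) : injective (@lift_perm n i j).
Proof.
move=> s t /permP st; apply/permP => k; apply: (@lift_inj _ j).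
by rewrite -!(lift_perm_lift i).
Qed.

Lemma facet_of_cell_inj N : injective (@facet_of_cell N).
Proof.
move=> [v s] [w t] [/ffunP vw /lift_perm_inj ->]; congr (_, _).
by apply/ffunP => i; have := vw (lift ord_max i); rewrite !extend0_lift.
Qed.

Lemma kuhn_vertex_facet_of_cell N c k : k <= n ->
  kuhn_vertex (@facet_of_cell N c).1 k = extend0 0 (kuhn_vertex c k).
Proof.
move=> kn; apply/ffunP => i; rewrite [LHS]ffunE; case: (unliftP ord_max i) => [j|] ->.
  by rewrite !extend0_lift ffunE /= lift_perm_lift lift_max.
by rewrite !extend0_max /= lift_perm_id /= ltnNge kn.
Qed.

Lemma facet_of_cell_exists N (v : {ffun 'I_n.+1 -> 'I_N.+1}) (s : {perm 'I_n.+1}) :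
  s ord_max = ord_max -> v ord_max = ord0 ->
  exists c, (v, s, ord_max) = facet_of_cell c.
Proof.
move=> sm vm.
have hs i : {j | s (lift ord_max i) = lift ord_max j}.
  have sl : ord_max != s (lift ord_max i).
    by rewrite -[X in X != _]sm (inj_eq perm_inj) neq_lift.
  by have [j sj _] := unlift_some sl; exists j.
pose f i := sval (hs i).
have fE i : s (lift ord_max i) = lift ord_max (f i) by rewrite /f; case: (hs i).
have finj : injective f.
  by move=> i j /(congr1 (lift ord_max)); rewrite -!fE => /perm_inj /lift_inj.
exists ([ffun i => v (lift ord_max i)], perm finj); congr (_, _, _).
  by apply/ffunP => i; rewrite !ffunE; case: unliftP => [j|] ->; rewrite ?ffunE.
apply/permP => i; case: (unliftP ord_max i) => [j|] ->.
  by rewrite lift_perm_lift permE fE.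
by rewrite lift_perm_id.
Qed.

Lemma door_facet_of_cell N lab c :
  door lab (@facet_of_cell N c) = fully_labelled (fun p => lab (extend0 0 p)) c.
Proof.
apply/forallP/forallP => h l; have /existsP[j] := h l.
  move=> /andP[/= jm E]; apply/existsP.
  exists (Ordinal (ltn_ord_neq_max jm)); rewrite -kuhn_vertex_facet_of_cell //=.
  by rewrite -ltnS ltn_ord_neq_max.
move=> E; apply/existsP; exists (lift ord_max j).
rewrite eq_sym neq_lift lift_max kuhn_vertex_facet_of_cell //.
by rewrite -ltnS.
Qed.

End Restriction.

(** Modulo 2, the fully labelled simplices are as many as the doors, hence as the
    doors on the boundary, and these are the fully labelled simplices of the
    face where the last coordinate vanishes. *)
Theorem sperner_cube n N (lab : {ffun 'I_n -> nat} -> nat) :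
  (forall p : {ffun 'I_n -> nat}, (forall i, p i <= N.+1) -> lab p <= n) ->
  (forall p : {ffun 'I_n -> nat}, (forall i, p i <= N.+1) ->
     forall i, p i = 0 -> lab p <= i) ->
  (forall p : {ffun 'I_n -> nat}, (forall i, p i <= N.+1) ->
     forall i, p i = N.+1 -> lab p <> i) ->
  odd #|[set c | @fully_labelled n N.+1 lab c]|.
Proof.
elim: n lab => [|n IH] lab labn lab0 labN.
  suff -> : [set c | @fully_labelled 0 N.+1 lab c] = finset.setT.
    by rewrite cardsT card_prod card_ffun !card_ord card_Sn fact0 muln1 expn0.
  apply/setP => c; rewrite !inE; apply/forallP => l; apply/existsP; exists ord0.
  by rewrite [l]ord1 /= -leqn0; apply: labn => -[].
rewrite odd_card_fully_labelled // (odd_card_fixed (g := @across_facet n N)).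
- have -> : [set x in [set x | door lab x] | across_facet x == x] =
      [set facet_of_cell c | c in
         [set c | @fully_labelled n N.+1 (fun p => lab (extend0 0 p)) c]].
    apply/setP => x; rewrite !inE; apply/andP/imsetP => [[dx /eqP gx]|[c]].
      have [km sm vm] := door_fixed lab0 labN dx gx.
      case: x km sm vm dx {gx} => [[v s] k] /= -> sm vm.
      have [c ->] := facet_of_cell_exists sm vm; rewrite door_facet_of_cell => dc.
      by exists c; rewrite ?inE.
    rewrite inE -door_facet_of_cell => dc ->; split=> //; apply/eqP.
    rewrite /facet_of_cell /across_facet /= eqxx.
    have -> : ((lift_perm ord_max ord_max c.2)^-1)%g ord_max = ord_max.
      by rewrite lift_permV lift_perm_id.
    by rewrite extend0_max.
  rewrite card_imset; last exact: facet_of_cell_inj.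
  have ext_box (p : {ffun 'I_n -> nat}) :
      (forall i, p i <= N.+1) -> forall i, extend0 0 p i <= N.+1.
    by move=> pN i; rewrite ffunE; case: unlift.
  apply: IH => p.
  + by move=> pN; apply: (lab0 _ _ ord_max); rewrite ?extend0_max //; exact: ext_box.
  + move=> pN i pi0; rewrite -[i : nat](lift_max i); apply: lab0; first exact: ext_box.
    by rewrite extend0_lift.
  + move=> pN i pi0; rewrite -[i : nat](lift_max i); apply: labN; first exact: ext_box.
    by rewrite extend0_lift.
- by move=> x; rewrite !inE => /door_across_facet.
- by move=> x _; exact: across_facetK.
Qed.

Local Open Scope classical_set_scope.
Local Open Scope ring_scope.

(** * Sup norm and compactness on row vectors *)

Section RowNorm.
Variables (R : realType) (n : nat).
Implicit Types x y : 'rV[R]_n.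

Lemma coord_le_norm x i : `|x ord0 i| <= `|x|.
Proof.
rewrite [leRHS]mx_normrE.
exact: (le_bigmax _ (fun ij : 'I_1 * 'I_n => `|x ij.1 ij.2|) (ord0, i)).
Qed.

Lemma norm_rV_le x e : 0 <= e -> (forall i, `|x ord0 i| <= e) -> `|x| <= e.
Proof.
move=> e0 h; rewrite [leLHS]mx_normrE; apply: bigmax_le => // -[i j] _ /=.
by rewrite [i]ord1.
Qed.

Lemma compact_norm_le (r : R) : compact [set x : 'rV[R]_n | `|x| <= r].
Proof.
apply: bounded_closed_compact.
  exists r; split; first exact: num_real.
  by move=> s rs x /= xr; exact: le_trans xr (ltW rs).
have -> : [set x : 'rV[R]_n | `|x| <= r] =
  (fun x : 'rV[R]_n => `|x|) @^-1` [set t | t <= r] by [].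
by apply: closed_comp; [move=> x _; exact: norm_continuous|exact: closed_le].
Qed.

Lemma cluster_seq_norm_le (r : R) (u : nat -> 'rV[R]_n) :
  (forall k, `|u k| <= r) ->
  exists2 z, `|z| <= r & forall (m : nat) (e : R), 0 < e ->
    exists2 k, (m <= k)%N & `|u k - z| < e.
Proof.
move=> ur.
have [|z [/= zr cz]] := @compact_norm_le r (u k @[k --> \oo]) _.
  by apply: (@filterE _ (nbhs \oo)) => k; exact: ur.
exists z => // m e e0.
have [||y [[k /= mk <-] /=]] := cz [set u k | k in [set k | (m <= k)%N]] (ball z e).
- by exists m => // k mk; exists k.
- exact: nbhsx_ballx.
- by rewrite -ball_normE /= distrC => h; exists k.
Qed.

End RowNorm.

(** * The Poincare-Miranda theorem *)

Section PoincareMiranda.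
Variables (R : realType) (n : nat).

Definition grid_point (N : nat) (p : {ffun 'I_n -> nat}) : 'rV[R]_n :=
  \row_i (2 * (p i)%:R / N.+1%:R - 1).

Lemma grid_point_norm N (p : {ffun 'I_n -> nat}) :
  (forall i, (p i <= N.+1)%N) -> `|grid_point N p| <= 1.
Proof.
move=> pN; apply: norm_rV_le => // i; rewrite mxE ler_norml.
have N0 : 0 < N.+1%:R :> R by rewrite ltr0n.
have : 0 <= ((p i)%:R / N.+1%:R : R) <= 1.
  by rewrite divr_ge0 //= ler_pdivrMr // mul1r ler_nat.
rewrite -mulrA; move: ((p i)%:R / _) => t /andP[? ?].
  by apply/andP; split; lra.
Qed.

Lemma grid_point_dist N (p q : {ffun 'I_n -> nat}) :
  (forall i, (p i <= (q i).+1)%N) -> (forall i, (q i <= (p i).+1)%N) ->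
  `|grid_point N p - grid_point N q| <= 2 / N.+1%:R.
Proof.
move=> pq qp; apply: norm_rV_le => [|i]; first by rewrite divr_ge0.
have := qp i; have := pq i; rewrite -!(ler_nat R).
rewrite -[(q i).+1%:R]natr1 -[(p i).+1%:R]natr1 => h1 h2.
rewrite !mxE.
have -> : 2 * (p i)%:R / N.+1%:R - 1 - (2 * (q i)%:R / N.+1%:R - 1) =
  ((p i)%:R - (q i)%:R) * (2 / N.+1%:R) :> R by ring.
have c0 : 0 <= 2 / N.+1%:R :> R by rewrite divr_ge0.
rewrite normrM (ger0_norm c0) ler_piMl // ler_norml; apply/andP; split; lra.
Qed.

Variable H : 'rV[R]_n -> 'rV[R]_n.
Hypothesis H_lo : forall (x : 'rV[R]_n) i,
  `|x| <= 1 -> x ord0 i = -1 -> H x ord0 i < 0.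
Hypothesis H_hi : forall (x : 'rV[R]_n) i,
  `|x| <= 1 -> x ord0 i = 1 -> 0 <= H x ord0 i.

(** The number of leading coordinates of H that are nonnegative.  The signs of H
    on the faces give the boundary conditions of [sperner_cube], and a simplex
    with all labels sees a negative value of every coordinate, and a point where
    all coordinates are nonnegative. *)
Definition sign_label N (p : {ffun 'I_n -> nat}) : nat :=
  find (fun i => H (grid_point N p) ord0 i < 0) (enum 'I_n).

Lemma sign_label_lt N p (i : 'I_n) :
  sign_label N p = i -> H (grid_point N p) ord0 i < 0.
Proof.
move=> E.
have := @nth_find _ i (fun i => H (grid_point N p) ord0 i < 0) (enum 'I_n).
rewrite -/(sign_label N p) E nth_ord_enum; apply.
by rewrite has_find -/(sign_label N p) E size_enum_ord.
Qed.

Lemma sign_label_ge N p (i : 'I_n) :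
  (i < sign_label N p)%N -> 0 <= H (grid_point N p) ord0 i.
Proof. by move=> /(before_find i); rewrite nth_ord_enum => /negbT; rewrite -leNgt. Qed.

Lemma sign_changing_cell N : exists x : 'rV[R]_n, `|x| <= 1 /\
  [/\ forall i, exists y : 'rV[R]_n,
        [/\ `|y| <= 1, `|y - x| <= 2 / N.+1%:R & H y ord0 i < 0]
    & exists y : 'rV[R]_n, [/\ `|y| <= 1, `|y - x| <= 2 / N.+1%:R
                  & forall i, 0 <= H y ord0 i]].
Proof.
have : odd #|finset (fun c => @fully_labelled n N.+1 (sign_label N) c)|.
  apply: sperner_cube => p pN.
  - by rewrite /sign_label (leq_trans (find_size _ _)) // size_enum_ord.
  - move=> i pi0; rewrite leqNgt; apply/negP => /sign_label_ge.
    rewrite leNgt H_lo ?grid_point_norm //.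
    by rewrite mxE pi0 mulr0 mul0r sub0r.
  - move=> i piN /sign_label_lt; apply/negP; rewrite -leNgt.
    rewrite H_hi ?grid_point_norm //.
    by rewrite mxE piN mulfK ?pnatr_eq0 //; lra.
move=> /odd_gt0/card_gt0P[c]; rewrite inE => /forallP full.
pose vtx k := grid_point N (kuhn_vertex c k).
have vtx1 k : `|vtx k| <= 1.
  by apply: grid_point_norm => i; exact: kuhn_vertex_le.
have vtxd k : `|vtx k - vtx 0%N| <= 2 / N.+1%:R.
  apply: grid_point_dist => i; rewrite !ffunE;
    by case: (_ < k)%N; case: (_ < 0)%N; lia.
exists (vtx 0%N); split=> //; split.
  move=> i; have /existsP[k /eqP ki] := full (widen_ord (leqnSn n) i).
  by exists (vtx k); split=> //; apply: sign_label_lt.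
have /existsP[k /eqP ki] := full ord_max.
by exists (vtx k); split=> // i; apply: sign_label_ge; rewrite ki.
Qed.

(** At a cluster point of ever smaller sign-changing cells, no coordinate of H can
    be nonzero, since its sign would be constant nearby. *)
Theorem poincare_miranda :
  (forall x : 'rV[R]_n, `|x| <= 1 -> {for x, continuous H}) ->
  exists2 x : 'rV[R]_n, `|x| <= 1 & H x = 0.
Proof.
move=> cH; have [u uP] := choice sign_changing_cell.
have [z z1 zP] := cluster_seq_norm_le (fun k => (uP k).1).
exists z => //; apply/rowP => i; rewrite mxE.
have cHi : {for z, continuous ((fun M : 'rV[R]_n => M ord0 i) \o H)}.
  by apply: continuous_comp (cH z z1) _; exact: coord_continuous.
have near_cell (P : R -> Prop) : (\forall y \near z, P (H y ord0 i)) ->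
    exists N, forall y, `|y - u N| <= 2 / N.+1%:R -> P (H y ord0 i).
  move=> /nbhs_ballP[r /= r0 zr].
  have [m /= mr] : exists m, 2 / m.+1%:R < r / 2.
    have := archi_boundP (divr_ge0 (ler0n R 4) (ltW r0)).
    move: (Num.bound _) => b; rewrite ltr_pdivrMr // => hb; exists b.
    rewrite ltr_pdivrMr ?ltr0n // -[b.+1%:R]natr1.
    by move: (b%:R) hb => t; nra.
  have [k mk kz] := zP m (r / 2) ltac:(lra).
  exists k => y yu; apply: zr; rewrite -ball_normE /= distrC.
  have : 2 / k.+1%:R <= 2 / m.+1%:R :> R.
    by rewrite ler_wpM2l // lef_pV2 ?posrE ?ltr0n // ler_nat ltnS.
  have := ler_normD (y - u k) (u k - z); rewrite addrA subrK.
  by move: yu mr kz; move: (2 / k.+1%:R) (2 / m.+1%:R) => s t; lra.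
have [Hz|Hz|//] := ltgtP (H z ord0 i) 0.
- have [N NP] := near_cell (fun t => t < 0) (cvgr_lt _ cHi _ Hz).
  have [_ [y [_ /NP + yH]]] := (uP N).2.
  by rewrite ltNge yH.
- have [N NP] := near_cell (fun t => 0 < t) (cvgr_gt _ cHi _ Hz).
  have [/(_ i)[y [_ /NP + yH]] _] := (uP N).2.
  by rewrite ltNge (ltW yH).
Qed.
End PoincareMiranda.

(** * Lipschitz images of the surface of a cube *)

Section LipschitzSphere.
Variables (R : realType) (m : nat).
Notation n := m.+1.

Lemma nearest_mesh (N : nat) (t : R) : 0 <= t <= 1 ->
  exists k : 'I_N.+1, `|t * N.+1%:R - k%:R| <= 1.
Proof.
move=> /andP[t0 t1].
have tN : 0 <= t * N.+1%:R by rewrite mulr_ge0.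
have := truncn_itv tN; set k := Num.truncn _ => /andP[kl ku].
have [kN|Nk] := ltnP k N.+1.
  exists (Ordinal kN); rewrite /= ler_norml; move: ku; rewrite -natr1 => ku.
  by apply/andP; split; lra.
exists ord_max => /=; rewrite ler_norml.
have : t * N.+1%:R <= N.+1%:R by rewrite ler_piMl.
have : N.+1%:R <= k%:R :> R by rewrite ler_nat.
move: kl; move: (t * _) {ku tN} => s.
rewrite -[N.+1%:R]natr1; move: (k%:R) (N%:R) => a b *.
by apply/andP; split; lra.
Qed.

(** A net of the surface of a cube: i and the boolean choose a face, and the finite
    function a mesh point of that face.  What matters is that its size grows with
    the exponent m = n - 1 of the mesh. *)
Lemma sphere_net (c : 'rV[R]_n) (eps : R) (N : nat) : 0 < eps ->
  exists rep : 'I_n * bool * {ffun 'I_m -> 'I_N.+1} -> 'rV[R]_n,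
    forall y, `|y - c| = eps -> exists p, `|y - rep p| <= 2 * eps / N.+1%:R.
Proof.
move=> e0.
pose rep (p : 'I_n * bool * {ffun 'I_m -> 'I_N.+1}) : 'rV[R]_n :=
  \row_j (c ord0 j + if unlift p.1.1 j is Some j'
                     then eps * (2 * (p.2 j')%:R / N.+1%:R - 1)
                     else (-1) ^+ p.1.2 * eps).
exists rep => y yc.
have [[i0 i] /= yi] : exists ij, `|y - c| = `|(y - c) ij.1 ij.2|.
  by apply: mx_norm_neq0; change (`|y - c| != 0); rewrite yc gt_eqF.
rewrite [i0]ord1 yc !mxE in yi.
have yj j : `|y ord0 j - c ord0 j| <= eps.
  by have := coord_le_norm (y - c) j; rewrite yc !mxE.
have hk j : exists k : 'I_N.+1,
    `|(y ord0 j - c ord0 j + eps) / (2 * eps) * N.+1%:R - k%:R| <= 1.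
  apply: nearest_mesh; have := yj j; rewrite ler_norml => /andP[h1 h2].
  by rewrite divr_ge0 ?ler_pdivrMr /=; lra.
have [k kP] := choice hk.
exists (i, y ord0 i - c ord0 i < 0, [ffun j' => k (lift i j')]).
have N0 : 0 < N.+1%:R :> R by rewrite ltr0n.
apply: norm_rV_le => [|j]; first by rewrite divr_ge0 // mulr_ge0 // ltW.
rewrite !mxE /=; case: (unliftP i j) => [j'|] ->.
  rewrite ffunE.
  have -> : y ord0 (lift i j') - (c ord0 (lift i j') +
      eps * (2 * (k (lift i j'))%:R / N.+1%:R - 1)) =
     ((y ord0 (lift i j') - c ord0 (lift i j') + eps) / (2 * eps) * N.+1%:R
       - (k (lift i j'))%:R) * (2 * eps / N.+1%:R).
    by field; rewrite ?gt_eqF //.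
  have c0 : 0 <= 2 * eps / N.+1%:R by rewrite divr_ge0 // mulr_ge0 // ltW.
  by rewrite normrM (ger0_norm c0) ler_piMl.
rewrite opprD addrA.
have -> : y ord0 i - c ord0 i - (-1) ^+ (y ord0 i - c ord0 i < 0)%R * eps = 0.
  case: ltP yi => h; rewrite ?expr1 ?expr0 => ->.
    by rewrite ltr0_norm //; ring.
  by rewrite ger0_norm //; ring.
by rewrite normr0 divr_ge0 // mulr_ge0 // ltW.
Qed.

(** A pigeonhole argument.  Among the M ^ n grid vectors v in a cube of side delta,
    two that cancel values of P over the same cell of a fine net are closer than
    the grid mesh, hence equal.  With mesh proportional to 1 / M on both sides,
    the net has only a multiple of M ^ (n - 1) cells, too few once M is large. *)
Lemma lipschitz_sphere_avoid (P : 'rV[R]_n -> 'rV[R]_n) (L : R)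
    (c : 'rV[R]_n) (eps delta : R) :
  0 < L -> (forall x y, `|P x - P y| <= L * `|x - y|) ->
  0 < eps -> 0 < delta ->
  exists2 v, `|v| <= delta & forall y, `|y - c| = eps -> P y + v != 0.
Proof.
move=> L0 PL e0 d0.
(* Each edge of the cube has K * M cells of the net, against M grid values; M
   exceeds the number 2 * n * (K * M) ^ m of cells divided by M ^ m. *)
pose q := 4 * L * eps / delta.
have q0 : 0 < q by rewrite divr_gt0 ?mulr_gt0.
pose K := (Num.bound q).+1.
have qK : q < K%:R.
  by apply: lt_le_trans (archi_boundP (ltW q0)) _; rewrite ler_nat.
pose M := (2 * n * K ^ m).+1.
pose N := (K * M).-1.
have NE : N.+1 = (K * M)%N by rewrite prednK.
have [rep repP] := sphere_net c N e0.
pose v (w : {ffun 'I_n -> 'I_M}) : 'rV[R]_n := \row_i (delta * (w i)%:R / M%:R).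
have M0 : 0 < M%:R :> R by rewrite ltr0n.
have vd w : `|v w| <= delta.
  apply: norm_rV_le => [|i]; first exact: ltW.
  have w0 : 0 <= delta * (w i)%:R / M%:R by rewrite divr_ge0 // mulr_ge0 // ltW.
  by rewrite mxE ger0_norm // ler_pdivrMr // ler_pM2l // ler_nat ltnW.
apply: contrapT => hall.
have hit w : exists p, `|P (rep p) + v w| <= L * (2 * eps / N.+1%:R).
  have [y yc /eqP Py] : exists2 y, `|y - c| = eps & P y + v w == 0.
    apply: contrapT => h; apply: hall; exists (v w) => // y yc.
    by apply/negP => Py; apply: h; exists y.
  have [p yp] := repP y yc; exists p.
  have -> : P (rep p) + v w = P (rep p) - P y.
    by apply/eqP; rewrite -subr_eq0 opprB addrACA addrC addrA addrNK addrC Py.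
  by apply: le_trans (PL _ _) _; rewrite distrC ler_pM2l.
have [f fP] := choice hit.
have finj : injective f.
  move=> w w' ww'; apply/ffunP => i; apply/val_inj/eqP; apply: contraT => wi.
  have vw : `|v w - v w'| <= 4 * L * eps / (K%:R * M%:R).
    have := ler_normB (P (rep (f w)) + v w) (P (rep (f w')) + v w').
    have := fP w; have := fP w'; rewrite -ww' opprD addrACA subrr add0r NE natrM.
    have -> : 4 * L * eps / (K%:R * M%:R) =
      L * (2 * eps / (K%:R * M%:R)) + L * (2 * eps / (K%:R * M%:R)) by ring.
    move: (L * (2 * eps / (K%:R * M%:R))) => ?; lra.
  have := le_trans (coord_le_norm (v w - v w') i) vw; rewrite !mxE.
  have -> : delta * (w i)%:R / M%:R - delta * (w' i)%:R / M%:R =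
    delta * ((w i)%:R - (w' i)%:R) / M%:R by ring.
  have wi1 : 1 <= `|(w i)%:R - (w' i)%:R| :> R.
    rewrite -[X in `|X|]/(((w i)%:Z)%:~R - ((w' i)%:Z)%:~R) -intrB -intr_norm.
    by rewrite ler1z -gtz0_ge1 normr_gt0 subr_eq0.
  rewrite !normrM (gtr0_norm d0) [X in _ * X]gtr0_norm ?invr_gt0 //.
  rewrite invfM mulrA ler_pM2r ?invr_gt0 // ler_pdivlMr ?ltr0n // => h.
  move: qK; rewrite ltr_pdivrMr // => /(le_lt_trans h).
  rewrite ltNge mulrAC [K%:R * _]mulrC ler_peMr //.
  by rewrite mulr_ge0 // ltW.
have := leq_card _ finj.
rewrite !card_prod !card_ffun !card_ord card_bool NE expnMn expnS.
have a0 : (0 < M ^ m)%N by rewrite expn_gt0.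
rewrite leqNgt => /negP; apply; rewrite mulnA ltn_pmul2r //.
by rewrite /M [(2 * n)%N]mulnC ltnS.
Qed.

End LipschitzSphere.

(** * Invariance of domain *)

Lemma compact_lower_bound (R : realType) (T : topologicalType)
    (g : T -> R) (A : set T) :
  compact A -> continuous g -> (forall x, A x -> 0 < g x) ->
  exists2 e, 0 < e & forall x, A x -> e <= g x.
Proof.
move=> cA cg gA; have [A0|/set0P/negP/negPn/eqP A0] := pselect (A !=set0); last first.
  by exists 1 => // x; rewrite A0.
have [z /[!inE] Az zmin] := compact_EVT_min A0 cA (continuous_subspaceT cg).
by exists (g z); [exact: gA|move=> x Ax; apply: zmin; rewrite inE].
Qed.

Section InvarianceOfDomain.
Variables (R : realType) (m : nat).
Notation n := m.+1.
Implicit Types x y : 'rV[R]_n.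

Lemma lipschitz_continuous (P : 'rV[R]_n -> 'rV[R]_n) (L : R) : 0 < L ->
  (forall x y, `|P x - P y| <= L * `|x - y|) -> continuous P.
Proof.
move=> L0 PL x; apply/(@cvgrPdist_lt _ _ _ (nbhs x)) => e e0.
apply/nbhs_ballP; exists (e / L) => [|y]; first exact: divr_gt0.
rewrite -ball_normE /= ltr_pdivlMr // mulrC => h.
exact: le_lt_trans (PL _ _) h.
Qed.

Variable f : 'rV[R]_n -> 'rV[R]_n.
Hypotheses (cf : continuous f) (injf : injective f).

(** McShane's formula P_i y = inf_x (x_i + L |y - f x|), over the unit cube, defines
    an L-Lipschitz map.  At y = f x' the infimum is at most x'_i; it is nearly
    that for large L, because by compactness and injectivity |f x - f x'| is
    bounded below for x away from x'. *)
Lemma lipschitz_approx_inverse (delta : R) : 0 < delta ->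
  exists L (P : 'rV[R]_n -> 'rV[R]_n),
    [/\ 0 < L, forall x y, `|P x - P y| <= L * `|x - y|
      & forall x, `|x| <= 1 -> forall i,
          x ord0 i - delta <= P (f x) ord0 i <= x ord0 i].
Proof.
move=> d0.
pose A := ([set x : 'rV[R]_n | `|x| <= 1] `*` [set x : 'rV[R]_n | `|x| <= 1])
  `&` [set p | delta <= `|p.1 - p.2|].
have cA : compact A.
  apply: compact_closedI; first by apply: compact_setX; exact: compact_norm_le.
  apply: (@preimage_closed _ _ (fun p : 'rV[R]_n * 'rV[R]_n => `|p.1 - p.2|)
            [set t | delta <= t]); last exact: closed_ge.
  by move=> p _; apply: cvg_norm; apply: cvgB; [exact: cvg_fst|exact: cvg_snd].
have cg : continuous (fun p : 'rV[R]_n * 'rV[R]_n => `|f p.1 - f p.2|).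
  move=> p; apply: cvg_norm; apply: cvgB.
    by apply: continuous_comp; [exact: cvg_fst|exact: cf].
  by apply: continuous_comp; [exact: cvg_snd|exact: cf].
have [|e e0 eP] := compact_lower_bound cA cg.
  move=> [x y] [_ /= dxy]; rewrite normr_gt0 subr_eq0.
  apply: contraTneq dxy => /injf ->.
  by rewrite subrr normr0 -ltNge.
(* Coordinates of points of the unit cube differ by at most 2. *)
pose L := 2 / e; have L0 : 0 < L by rewrite divr_gt0.
have sep x x' i : `|x| <= 1 -> `|x'| <= 1 ->
    x ord0 i - delta <= x' ord0 i + L * `|f x - f x'|.
  move=> x1 x'1; have dL : 0 <= L * `|f x - f x'| by rewrite mulr_ge0 // ltW.
  have := coord_le_norm (x - x') i; rewrite !mxE => xi.
  have [h|h] := ltP `|x - x'| delta.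
    by have := ler_norm (x ord0 i - x' ord0 i); lra.
  have := eP (x, x') (conj (conj x1 x'1) h); rewrite /= => exx.
  have : 2 <= L * `|f x - f x'| by rewrite /L mulrAC ler_pdivlMr // ler_pM2l.
  have := le_trans (coord_le_norm x i) x1.
  have := le_trans (coord_le_norm x' i) x'1.
  by rewrite !ler_norml => /andP[? ?] /andP[? ?]; lra.
pose E i y := [set x ord0 i + L * `|y - f x| | x in [set x : 'rV[R]_n | `|x| <= 1]].
have E0 i y : E i y !=set0.
  by exists ((0 : 'rV[R]_n) ord0 i + L * `|y - f 0|); exists 0 => //=; rewrite normr0.
have Elb i y : has_lbound (E i y).
  exists (-1) => _ [x /= x1 <-].
  have := le_trans (coord_le_norm x i) x1; rewrite ler_norml => /andP[? ?].
  have : 0 <= L * `|y - f x| by rewrite mulr_ge0 // ltW.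
  lra.
exists L, (fun y => \row_i inf (E i y)); split=> // [y z|x x1 i].
  have lip u w i : inf (E i u) <= inf (E i w) + L * `|u - w|.
    rewrite -lerBlDr; apply: lb_le_inf => // _ [x x1 <-].
    rewrite lerBlDr; apply: (@le_trans _ _ (x ord0 i + L * `|u - f x|)).
      by apply: ge_inf => //; exists x.
    rewrite -addrA lerD2l -mulrDr ler_pM2l // [leRHS]addrC.
    by have := ler_normD (u - w) (w - f x); rewrite addrA subrK.
  apply: norm_rV_le => [|i]; first by rewrite mulr_ge0 // ltW.
  rewrite !mxE ler_norml; have := lip y z i; have := lip z y i.
  by rewrite [`|z - y|]distrC => *; apply/andP; split; lra.
rewrite mxE; apply/andP; split.
  by apply: lb_le_inf => // _ [x' /= x'1 <-]; exact: sep.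
apply: ge_inf => //; exists x => //.
by rewrite subrr normr0 mulr0 addr0.
Qed.


(** Radial projection away from c onto the complement of the cube of radius eps. *)
Definition push_out (c : 'rV[R]_n) (eps : R) (y : 'rV[R]_n) : 'rV[R]_n :=
  c + Num.max 1 (eps / `|y - c|) *: (y - c).

Lemma push_out_id c eps y : 0 < eps -> eps <= `|y - c| -> push_out c eps y = y.
Proof.
move=> e0 ey; have y0 := lt_le_trans e0 ey.
rewrite /push_out max_l ?ler_pdivrMr ?mul1r //.
by rewrite scale1r addrC subrK.
Qed.

Lemma push_out_norm c eps y :
  y != c -> `|y - c| <= eps -> `|push_out c eps y - c| = eps.
Proof.
rewrite -subr_eq0 -normr_gt0 => y0 ye.
rewrite /push_out max_r ?ler_pdivlMr ?mul1r // addrC addKr normrZ.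
by rewrite normrM normfV normr_id ger0_norm ?divfK ?gt_eqF // (le_trans _ ye).
Qed.

Lemma push_out_continuous c eps y :
  y != c -> {for y, continuous (push_out c eps)}.
Proof.
move=> yc; have cB : {for y, continuous (fun z : 'rV[R]_n => z - c)}.
  by apply: (@cvgB _ _ _ (nbhs y)); [exact: cvg_id|exact: cvg_cst].
have cM : {for y, continuous
    ((fun=> 1 : R^o) \max (fun z : 'rV[R]_n => eps / `|z - c| : R^o))}.
  apply: continuous_max; first exact: cst_continuous.
  apply: (@cvgM _ _ (nbhs y)); first exact: cvg_cst.
  apply: (@cvgV _ _ (nbhs y)); first by rewrite normr_eq0 subr_eq0.
  exact: cvg_norm.
apply: (@cvgD _ _ _ (nbhs y) _ (fun=> c)); first exact: cvg_cst.
exact: (@cvgZ _ _ _ (nbhs y) _ _ _ _ _ cM cB).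
Qed.

(** Invariance of domain at the origin.  If the conclusion failed, the map H below
    would have no zero in the unit cube, against [poincare_miranda]. *)
Lemma image_ball_nbhs0 : nbhs (f 0) (f @` [set x | `|x| <= 1]).
Proof.
have cg : continuous (fun x : 'rV[R]_n => `|f x - f 0|).
  move=> x; apply: (@cvg_norm _ _ _ (nbhs x)); apply: (@cvgB _ _ _ (nbhs x)).
    exact: cf.
  exact: cvg_cst.
have cS : compact ([set x : 'rV[R]_n | `|x| <= 1] `&` [set x | 1 <= `|x|]).
  apply: compact_closedI; first exact: compact_norm_le.
  apply: (@preimage_closed _ _ (fun x : 'rV[R]_n => `|x|) [set t | 1 <= t]).
    by move=> x _; exact: norm_continuous.
  exact: closed_ge.
have [|mu mu0 muP] := compact_lower_bound cS cg.
  move=> x [_ /= x1]; rewrite normr_gt0 subr_eq0.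
  apply: contraTneq x1 => /injf ->.
  by rewrite normr0 -ltNge.
(* The cube of radius eps about any c within eps / 2 of f 0 misses the image of
   the faces, which are at distance at least 2 eps from f 0. *)
pose eps := mu / 2; have e0 : 0 < eps by rewrite divr_gt0.
apply: contrapT => not_nbhs.
have [c c0 cim] : exists2 c,
    `|c - f 0| < eps / 2 & ~ (f @` [set x | `|x| <= 1]) c.
  apply: contrapT => h; apply: not_nbhs; apply/nbhs_ballP; exists (eps / 2).
    by rewrite /= divr_gt0.
  move=> y; rewrite -ball_normE /= distrC => yd.
  by apply: contrapT => yim; apply: h; exists y.
have fc x : `|x| <= 1 -> f x != c.
  by move=> x1; apply/eqP => fxc; apply: cim; exists x.
have [delta [d0 d8 dP]] : exists delta, [/\ 0 < delta, delta <= 1 / 8 &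
    forall x, `|x| <= 2 * delta -> `|f x - f 0| < eps / 2].
  have eps20 : 0 < eps / 2 by rewrite divr_gt0.
  have /nbhs_ballP[r /= r0 rP] := cf (nbhsx_ballx (f 0) _ eps20).
  exists (Num.min (r / 3) (1 / 8)); split.
  - by rewrite lt_min !divr_gt0.
  - by rewrite ge_min lexx orbT.
  - move=> x xr; have := rP x; rewrite -!ball_normE /= sub0r normrN distrC; apply.
    have : Num.min (r / 3) (1 / 8) <= r / 3 by rewrite ge_min lexx.
    lra.
have [L [P [L0 PL Pinv]]] := lipschitz_approx_inverse d0.
have [v vd vP] := lipschitz_sphere_avoid c L0 PL e0 d0.
have vi i : - delta <= v ord0 i <= delta.
  by rewrite -ler_norml; apply: le_trans vd; exact: coord_le_norm.
pose H x := P (push_out c eps (f x)) + v.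
have face x i : `|x| <= 1 -> `|x ord0 i| = 1 -> push_out c eps (f x) = f x.
  move=> x1 xi; apply: push_out_id => //.
  have x1' : 1 <= `|x| by rewrite -xi coord_le_norm.
  have := muP x (conj x1 x1'); have := ler_normD (f x - c) (c - f 0).
  by rewrite addrA subrK /eps => *; move: c0; rewrite /eps; lra.
have [x i x1 xi|x i x1 xi|x x1|x x1 Hx] := @poincare_miranda R n H.
- rewrite /H (face x i) ?xi ?normrN1 // mxE.
  by have := Pinv x x1 i; have := vi i; rewrite xi => /andP[? ?] /andP[? ?]; lra.
- rewrite /H (face x i) ?xi ?normr1 // mxE.
  by have := Pinv x x1 i; have := vi i; rewrite xi => /andP[? ?] /andP[? ?]; lra.
- apply: (@cvgD _ _ _ (nbhs x)); last exact: cvg_cst.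
  apply: (@continuous_comp _ _ _ (push_out c eps \o f) P).
    by apply: continuous_comp; [exact: cf|apply: push_out_continuous; exact: fc].
  exact: (lipschitz_continuous L0 PL).
(* Either f x lies in the cube about c, and P + v vanishes on its surface; or
   f x is left in place, so that x is within 2 delta of 0 and f x within eps of
   c after all. *)
have [ex|xe] := leP eps `|f x - c|; last first.
  have /eqP := vP (push_out c eps (f x)) (push_out_norm (fc x x1) (ltW xe)).
  by rewrite -/(H x) Hx.
have : `|x| <= 2 * delta.
  apply: norm_rV_le => [|i]; first lra.
  have /rowP/(_ i) := Hx; rewrite /H push_out_id // !mxE ler_norml.
  have := Pinv x x1 i; have := vi i => /andP[? ?] /andP[? ?] ?.
  by apply/andP; split; lra.
move=> /dP fx; have := ler_normD (f x - f 0) (f 0 - c).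
by rewrite addrA subrK [`|f 0 - c|]distrC; lra.
Qed.
End InvarianceOfDomain.

(** The previous lemma at the point g y and at scale e / 2: the image under f of a
    small cube about g y is a neighbourhood of y. *)
Lemma continuous_inverse (R : realType) (m : nat)
    (f g : 'rV[R]_m.+1 -> 'rV[R]_m.+1) :
  continuous f -> cancel f g -> cancel g f -> continuous g.
Proof.
move=> cf fK gK y U /nbhs_ballP[e /= e0 eU].
pose x0 := g y; pose r := e / 2; have r0 : 0 < r by rewrite divr_gt0.
pose h (x : 'rV[R]_m.+1) := f (x0 + r *: x).
have ca : continuous (fun x : 'rV[R]_m.+1 => x0 + r *: x).
  move=> x; apply: (@cvgD _ _ _ (nbhs x)); first exact: cvg_cst.
  by apply: (@cvgZ _ _ _ (nbhs x)); [exact: cvg_cst|exact: cvg_id].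
have ch : continuous h by move=> x; exact: continuous_comp (ca x) (cf _).
have ih : injective h.
  move=> u v /(can_inj fK) /addrI /scalerI; apply.
  by rewrite gt_eqF.
have := image_ball_nbhs0 ch ih; rewrite {1}/h scaler0 addr0 gK.
apply: filterS => _ [x /= x1 <-]; rewrite /h fK; apply: eU.
rewrite -ball_normE /= opprD addNKr normrN normrZ gtr0_norm //.
have : r * `|x| <= r by rewrite ler_piMr // ltW.
rewrite /r; lra.
Qed.

(** The inverse is continuous, hence bounded on balls. *)
Lemma continuous_bijection_proper (R : realType) (m : nat)
    (f : 'rV[R]_m.+1 -> 'rV[R]_m.+1) : continuous f -> bijective f ->
  forall r, exists rho, forall x, rho < `|x| -> r < `|f x|.
Proof.
move=> cf [g fK gK] r; have cg := continuous_inverse cf fK gK.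
have [r0|r0] := ltP r 0; first by exists 0 => x _; exact: lt_le_trans r0 _.
have cng : continuous (fun y : 'rV[R]_m.+1 => `|g y|).
  by move=> y; apply: (@cvg_norm _ _ _ (nbhs y)); exact: cg.
have [|y _ ymax] := compact_EVT_max _ (@compact_norm_le R m.+1 r)
  (continuous_subspaceT cng).
  by exists 0; rewrite /= normr0.
exists `|g y| => x; rewrite !ltNge; apply: contra => fxr.
by rewrite -[x in leLHS]fK; apply: ymax; rewrite inE.
Qed.

(** * Comparison functions *)

Section ComparisonFunctions.
Variable R : realType.

(** The strictly increasing factor s / (1 + s), at most 1, makes a nondecreasing
    function strictly increasing; the absolute value keeps it continuous on all
    of R. *)
Lemma class_Kinfty_of_nondecreasing (a : R -> R) : continuous a -> a 0 = 0 ->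
  (forall s t, s <= t -> a s <= a t) -> (forall s, 0 < s -> 0 < a s) ->
  (forall M, exists s, M <= a s) ->
  class_Kinfty (fun s => s / (1 + `|s|) * a s).
Proof.
move=> ca a0 amono apos ainf; split.
- apply: continuous_subspaceT => s.
  apply: (@cvgM _ _ (nbhs s)); last exact: ca.
  apply: (@cvgM _ _ (nbhs s)); first exact: cvg_id.
  apply: (@cvgV _ _ (nbhs s)); first by rewrite gt_eqF // ltr_wpDr.
  apply: (@cvgD _ _ _ (nbhs s)); first exact: cvg_cst.
  exact: norm_continuous.
- by rewrite mul0r mul0r.
- move=> s t s0 st; have t0 := le_lt_trans s0 st.
  apply: (@le_lt_trans _ _ (s / (1 + `|s|) * a t)).
    by rewrite ler_wpM2l ?divr_ge0 ?addr_ge0 // amono // ltW.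
  rewrite ltr_pM2r ?apos // !ger0_norm ?(ltW t0) //.
  rewrite ltr_pdivrMr ?ltr_wpDr // mulrAC ltr_pdivlMr ?ltr_wpDr ?(ltW t0) //.
  by nra.
- apply/cvgryPge => M; have [s0 s0M] := ainf (2 * `|M|).
  near=> s.
  have s1 : 1 <= s by near: s; apply: nbhs_pinfty_ge; rewrite num_real.
  have ss0 : s0 <= s by near: s; apply: nbhs_pinfty_ge; rewrite num_real.
  have half : 1 / 2 <= s / (1 + `|s|).
    rewrite ger0_norm; last lra.
    by rewrite ler_pdivlMr; lra.
  have aM := le_trans s0M (amono _ _ ss0).
  apply: (@le_trans _ _ (1 / 2 * a s)); first by have := ler_norm M; lra.
  by rewrite ler_wpM2r //; have := normr_ge0 M; lra.
Unshelve. all: by end_near. Qed.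


Lemma continuous_lipschitz1 (a : R -> R) :
  (forall s t, a s <= a t + `|s - t|) -> continuous a.
Proof.
move=> lip s; apply/cvgrPdist_lt => e e0; apply/nbhs_ballP; exists e => // t.
rewrite /ball /= => st; apply: le_lt_trans st.
rewrite ler_norml; have := lip s t; have := lip t s; rewrite [`|t - s|]distrC.
by move=> ? ?; apply/andP; split; lra.
Qed.

Variable n : nat.
Implicit Types x : 'rV[R]_n.

Lemma norm_le_norm_2 x : `|x| <= norm_2 x.
Proof.
apply: norm_rV_le => [|i]; first exact: sqrtr_ge0.
rewrite -sqrtr_sqr ler_sqrt; last by apply: sumr_ge0 => j _; exact: sqr_ge0.
by rewrite (bigD1 i) //= lerDl sumr_ge0 // => j _; exact: sqr_ge0.
Qed.

Lemma norm_2_le_norm x : norm_2 x <= n.+1%:R * `|x|.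
Proof.
rewrite -[leRHS]ger0_norm ?mulr_ge0 // -sqrtr_sqr ler_sqrt ?sqr_ge0 //.
apply: (@le_trans _ _ (\sum_(i < n) `|x| ^+ 2)).
  apply: ler_sum => i _; rewrite -real_normK ?num_real //.
  by rewrite ler_sqr ?nnegrE // coord_le_norm.
rewrite sumr_const card_ord -[leLHS]mulr_natl exprMn ler_wpM2r ?sqr_ge0 //.
by rewrite -natrX ler_nat expnS expn1; lia.
Qed.

Variable W : 'rV[R]_n -> R.
Hypotheses (cW : continuous W) (W0 : W 0 = 0).
Hypothesis Wpos : forall x, x != 0 -> 0 < W x.

Let Wge0 x : 0 <= W x.
Proof. by have [->|/Wpos/ltW //] := eqVneq x 0; rewrite W0. Qed.

Section Minorant.
Hypothesis Wproper : forall M, exists rho, forall x, rho < `|x| -> M < W x.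

Lemma away_from_origin t :
  0 < t -> exists2 e, 0 < e & forall x, t <= `|x| -> e <= W x.
Proof.
move=> t0; have [rho rhoP] := Wproper 1.
have cS : compact ([set x : 'rV[R]_n | `|x| <= rho] `&` [set x | t <= `|x|]).
  apply: compact_closedI; first exact: compact_norm_le.
  apply: (@preimage_closed _ _ (fun x : 'rV[R]_n => `|x|) [set u | t <= u]).
    by move=> x _; exact: norm_continuous.
  exact: closed_ge.
have [x [_ /= tx]|e e0 eP] := compact_lower_bound cS cW.
  by apply: Wpos; rewrite -normr_gt0 (lt_le_trans t0).
exists (Num.min 1 e) => [|x tx]; first by rewrite lt_min ltr01.
rewrite ge_min; have [h|/rhoP/ltW ->//] := leP `|x| rho.
by apply/orP; right; exact: eP.
Qed.

(* minorant s = inf_x (W x + max 0 (s - |x|)) is 1-Lipschitz in s, as an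
   infimum of 1-Lipschitz functions, and taking x itself gives
   minorant |x| <= W x. *)
Let minorant_set s := [set W x + Num.max 0 (s - `|x|) | x in [set: 'rV[R]_n]].
Let minorant s := inf (minorant_set s).

Let minorant_lb s : has_lbound (minorant_set s).
Proof. by exists 0 => _ [x _ <-]; rewrite addr_ge0 // le_max lexx. Qed.

Let minorant_n0 s : minorant_set s !=set0.
Proof. by exists (W 0 + Num.max 0 (s - `|0 : 'rV[R]_n|)); exists 0. Qed.

Let minorant_le s x : minorant s <= W x + Num.max 0 (s - `|x|).
Proof. by apply: ge_inf => //; exists x. Qed.

Let le_minorant s c :
  (forall x, c <= W x + Num.max 0 (s - `|x|)) -> c <= minorant s.
Proof. by move=> h; apply: lb_le_inf => // _ [x _ <-]. Qed.

(** Rescaling the argument by n + 1 passes from the sup norm to the Euclidean norm. *)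
Lemma Kinfty_minorant : exists2 alpha : R -> R, class_Kinfty alpha &
  forall x, alpha (norm_2 x) <= W x.
Proof.
have k0 : 0 < n.+1%:R :> R by rewrite ltr0n.
pose a s := minorant (s / n.+1%:R).
have mono s t : s <= t -> minorant s <= minorant t.
  move=> st; apply: le_minorant => x; apply: le_trans (minorant_le s x) _.
  by rewrite lerD2l le_max2 // lerD2r.
have lip s t : minorant s <= minorant t + `|s - t|.
  rewrite -lerBlDr; apply: le_minorant => x; rewrite lerBlDr.
  apply: le_trans (minorant_le s x) _; rewrite -addrA lerD2l ge_max.
  have : 0 <= Num.max 0 (t - `|x|) by rewrite le_max lexx.
  have : t - `|x| <= Num.max 0 (t - `|x|) by rewrite le_max lexx orbT.
  have := ler_norm (s - t); have := normr_ge0 (s - t).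
  by move=> *; apply/andP; split; lra.
have nonneg s : 0 <= minorant s.
  by apply: le_minorant => x; rewrite addr_ge0 // le_max lexx.
(* Where |x| < s / 2 the second summand is at least s / 2. *)
have lower s e :
    (forall x, s / 2 <= `|x| -> e <= W x) -> Num.min e (s / 2) <= minorant s.
  move=> h; apply: le_minorant => x; rewrite ge_min.
  have [/h ex|xs] := leP (s / 2) `|x|.
    by apply/orP; left; rewrite (le_trans ex) // lerDl le_max lexx.
  apply/orP; right.
  have : s - `|x| <= Num.max 0 (s - `|x|) by rewrite le_max lexx orbT.
  by have := Wge0 x; lra.
exists (fun s => s / (1 + `|s|) * a s).
  apply: class_Kinfty_of_nondecreasing.
  - have := continuous_lipschitz1 lip => cm s.
    apply: (@continuous_comp _ _ _ (fun s : R => s / n.+1%:R) minorant); last exact: cm.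
    by apply: (@cvgM _ _ (nbhs s)); [exact: cvg_id|exact: cvg_cst].
  - apply/eqP; rewrite eq_le nonneg andbT (le_trans (minorant_le _ 0)) //.
    by rewrite W0 mul0r normr0 subr0 maxxx addr0.
  - by move=> s t st; apply: mono; rewrite ler_pM2r ?invr_gt0.
  - move=> s s0; have s20 : 0 < s / n.+1%:R / 2 by rewrite !divr_gt0.
    have [e e0 eP] := away_from_origin s20.
    by apply: lt_le_trans (lower _ _ eP); rewrite lt_min e0.
  - move=> M; have [rho rhoP] := Wproper M.
    pose s := 2 * (`|M| + `|rho| + 1); exists (s * n.+1%:R).
    rewrite /a mulfK ?gt_eqF //.
    have := ler_norm M; have := ler_norm rho.
    have := normr_ge0 M; have := normr_ge0 rho.
    move=> *; apply: le_trans (lower s M _); last first.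
      by move=> x sx; apply/ltW/rhoP; apply: lt_le_trans sx; rewrite /s; lra.
    by rewrite le_min lexx /= /s; lra.
move=> x; have x2 : 0 <= norm_2 x := sqrtr_ge0 _.
apply: (@le_trans _ _ (a (norm_2 x))).
  rewrite ler_piMl //; first exact: nonneg.
  by rewrite ger0_norm // ler_pdivrMr ?ltr_wpDr //; lra.
apply: le_trans (minorant_le _ x) _; rewrite gerDl ge_max lexx /= subr_le0.
by rewrite ler_pdivrMr // mulrC norm_2_le_norm.
Qed.

End Minorant.

Section Majorant.

(* majorant s is the supremum of W over the ball of radius s, parametrized by the
   unit ball so that continuity in s follows from compactness. *)
Let ray_set s := [set W (s *: u) | u in [set u : 'rV[R]_n | `|u| <= 1]].
Let majorant s := sup (ray_set s).

Let ray_ub s : has_ubound (ray_set s).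
Proof.
have cWs : continuous (fun u : 'rV[R]_n => W (s *: u)).
  move=> u.
  apply: (@continuous_comp _ _ _ (fun u : 'rV[R]_n => s *: u) W); last exact: cW.
  by apply: (@cvgZ _ _ _ (nbhs u)); [exact: cvg_cst|exact: cvg_id].
have [|u _ umax] := compact_EVT_max _ (@compact_norm_le R n 1)
  (continuous_subspaceT cWs).
  by exists 0; rewrite /= normr0.
by exists (W (s *: u)) => _ [v v1 <-]; apply: umax; rewrite inE.
Qed.

Let ray_n0 s : ray_set s !=set0.
Proof. by exists (W (s *: 0)); exists 0 => //=; rewrite normr0. Qed.

Let le_majorant s u : `|u| <= 1 -> W (s *: u) <= majorant s.
Proof. by move=> u1; apply: ub_le_sup => //; exists u. Qed.

Let majorant_le s c :
  (forall u, `|u| <= 1 -> W (s *: u) <= c) -> majorant s <= c.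
Proof. by move=> h; apply: ge_sup => // _ [u u1 <-]; exact: h. Qed.

Let majorant_continuous : continuous majorant.
Proof.
move=> s; apply/cvgrPdist_le => e e0.
have := (compact_near_coveringP _).1 (@compact_norm_le R n 1) R (nbhs s)
  (fun t u => `|W (s *: u) - W (t *: u)| < e) _.
have : forall u : 'rV[R]_n, `|u| <= 1 -> \forall u' \near u & t \near s,
    `|W (s *: u') - W (t *: u')| < e.
  move=> u _.
  have cQ : (fun p : 'rV[R]_n * R => W (s *: p.1) - W (p.2 *: p.1)) q
      @[q --> (u, s)] --> (0 : R).
    rewrite -[X in _ --> X](subrr (W (s *: u))); apply: cvgB.
      apply: (@continuous_comp _ _ _
        (fun p : 'rV[R]_n * R => s *: p.1) W (u, s)); last exact: cW.
      by apply: cvgZ; [exact: cvg_cst|exact: cvg_fst].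
    apply: (@continuous_comp _ _ _
      (fun p : 'rV[R]_n * R => p.2 *: p.1) W (u, s)); last exact: cW.
    by apply: cvgZ; [exact: cvg_snd|exact: cvg_fst].
  have cQe := cvgr_dist_lt _ _ cQ _ e0.
  apply: (@filterS _ (nbhs (u, s)) _ _ _ _ (cQe _)) => -[u' t] /=.
  by rewrite sub0r normrN.
move=> h /(_ _ h); apply: filterS => t /= close.
rewrite ler_norml; apply/andP; split.
  rewrite lerBrDr -lerBrDl ; apply: majorant_le => u u1.
  have := close u u1; have := le_majorant s u1.
  by rewrite ltr_norml => ? /andP[? ?]; lra.
rewrite lerBlDl addrC -lerBlDl; rewrite lerBlDr; apply: majorant_le => u u1.
have := close u u1; have := le_majorant t u1.
by rewrite ltr_norml => ? /andP[? ?]; lra.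
Qed.

Lemma Kinfty_majorant : exists2 alpha : R -> R, class_Kinfty alpha &
  forall x, W x <= alpha (norm_2 x).
Proof.
have mono s t : 0 <= s -> s <= t -> majorant s <= majorant t.
  move=> s0; case: (ltgtP 0 s) s0 => // [s0 _ st|<- _ t0]; last first.
    apply: majorant_le => u u1; rewrite scale0r W0.
    by apply: le_trans (le_majorant t u1); exact: Wge0.
  have t0 := lt_le_trans s0 st.
  apply: majorant_le => u u1.
  have -> : s *: u = t *: ((s / t) *: u).
    by rewrite scalerA mulrC divfK ?gt_eqF.
  apply: le_majorant; rewrite normrZ gtr0_norm ?divr_gt0 //.
  rewrite -[leRHS]mulr1 ler_pM // ?divr_ge0 ?ler_pdivrMr ?mul1r // ltW //.
have maj0 : majorant 0 = 0.
  apply/eqP; rewrite eq_le; apply/andP; split.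
    by apply: majorant_le => u _; rewrite scale0r W0.
  by apply: le_trans (@le_majorant 0 0 _); rewrite ?normr0 // scale0r W0.
have majW x : W x <= majorant `|x|.
  have [->|x0] := eqVneq x 0; first by rewrite W0 normr0 maj0.
  have nx : 0 < `|x| by rewrite normr_gt0.
  have {1}-> : x = `|x| *: (`|x|^-1 *: x) by rewrite scalerA mulfV ?gt_eqF // scale1r.
  apply: le_majorant; rewrite normrZ normfV normr_id mulVf // gt_eqF //.
exists (fun s => s + majorant s); last first.
  move=> x; apply: le_trans (majW x) _.
  apply: le_trans (mono _ _ (normr_ge0 x) (norm_le_norm_2 x)) _.
  by rewrite lerDr sqrtr_ge0.
split.
- apply: continuous_subspaceT => s.
  by apply: (@cvgD _ _ _ (nbhs s)); [exact: cvg_id|exact: majorant_continuous].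
- by rewrite maj0 addr0.
- by move=> s t s0 st; apply: ltr_leD => //; apply: mono => //; exact: ltW.
- apply/cvgryPge => M; near=> s.
  have s0 : 0 <= s by near: s; apply: nbhs_pinfty_ge; rewrite num_real.
  have sM : M <= s by near: s; apply: nbhs_pinfty_ge; rewrite num_real.
  by have := mono _ _ (lexx 0) s0; rewrite maj0; lra.
Unshelve. all: by end_near. Qed.

End Majorant.

Lemma Lyap0_of_radially_unbounded :
  (forall M, exists rho, forall x, rho < `|x| -> M < W x) -> Lyap0 W.
Proof.
move=> /Kinfty_minorant[a1 Ka1 a1W]; have [a2 Ka2 Wa2] := Kinfty_majorant.
by split=> //; exists a1, a2; split=> // x; rewrite a1W Wa2.
Qed.

End ComparisonFunctions.

Lemma Lyap0_comp (R : realType) (n : nat) (V : 'rV[R]_n -> R)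
    (f : 'rV[R]_n -> 'rV[R]_n) :
  (0 < n)%N -> continuous f -> f 0 = 0 -> bijective f ->
  Lyap0 V -> Lyap0 (V \o f).
Proof.
case: n V f => // m V f _ cf f0 bf.
move=> [cV V0 V00 Vpos [a1 [a2 [[_ _ a1mono a1inf] _ a1V]]]].
apply: Lyap0_of_radially_unbounded => [x||x x0|M].
- exact: continuous_comp (cf x) (cV _).
- by rewrite /= f0.
- by apply: Vpos; apply: contra_neq x0 => fx; apply: (bij_inj bf); rewrite fx f0.
have [r [r0 rM]] : exists r, 0 <= r /\ M <= a1 r.
  have /cvgryPge/(_ M) := a1inf; move=> [r [_ rP]].
  exists (`|r| + 1); split; first by rewrite addr_ge0.
  by apply: rP; have := ler_norm r; lra.
have [rho rhoP] := continuous_bijection_proper cf bf r.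
exists rho => x /rhoP fx; have /andP[+ _] := a1V (f x); apply: lt_le_trans.
apply: le_lt_trans rM _; apply: a1mono => //.
exact: lt_le_trans fx (norm_le_norm_2 _).
Qed.

(** * Certificates on the lifted graph *)

Section Certificate.
Variables (R : realType) (Sigma : finType) (G : fin_ldigraph Sigma) (n : nat).
Variables (f : Sigma -> 'rV[R]_n -> 'rV[R]_n) (v : fnode G -> 'rV[R]_n -> R).

(** The function V_s o f_{j_1} o ... o f_{j_T} represented by the lifted node
    (s, j_1, ..., j_T). *)
Definition node_function (p : node (composition_lift G)) : 'rV[R]_n -> R :=
  fun x => v p.1 (foldr f x p.2).

Lemma node_function_rcons p k x :
  node_function (node_rcons p k) x = node_function p (f k x).
Proof. by rewrite /node_function /= foldr_rcons. Qed.

Hypothesis v_cert : forall (a b : fnode G) (i : Sigma),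
  (a, b, i) \in fedges G -> forall x, v b (f i x) <= v a x.

(** A generating step leads from (a, w) to (b, i :: w) for some edge (a, b, i); it
    is the inequality of that edge at the image of x under the maps of w. *)
Lemma lift_geq_node_function p q : lift_geq p q ->
  forall x, node_function q x <= node_function p x.
Proof.
elim=> [{}p {}q [r [k [[T e] ->]]] x|//|{}p r {}q _ pr _ rq x]; last first.
  exact: le_trans (rq x) (pr x).
rewrite node_function_rcons /node_function.
case: e => [a b i /= abi|{}T a b i w j /= abi _]; first exact: v_cert.
by rewrite foldr_rcons; exact: v_cert.
Qed.

End Certificate.

Theorem mainTheorem5 (R : realType) (Sigma : finType)
    (G Gt : fin_ldigraph Sigma) (F : dynamics_family R) :
  path_complete G -> path_complete Gt ->
  class_of_dynamics F -> invertible_dynamics F ->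
  simulates (transitive_composition_lift G) Gt ->
  forall V : template R, closed_under_forward_composition V F ->
    certificate_le V F G Gt.
Proof.
move=> _ _ dynF invF [r rE] V closedV n n0 f fF [v [vV v_cert]].
exists (fun s => node_function f v (r s)); split=> [s|a b i abi x]; last first.
  rewrite -node_function_rcons.
  exact: lift_geq_node_function v_cert _ _ (rE _ _ _ abi) x.
case: (r s) => a w; elim/last_ind: w => [|w k [IHV IHL]]; first exact: vV.
have -> : node_function f v (a, rcons w k) = node_function f v (a, w) \o f k.
  by apply/funext => x; exact: (node_function_rcons f v (a, w)).
have [cf f0] := dynF n n0 _ (fF k).
split; first exact: closedV.
by apply: Lyap0_comp => //; exact: invF.
Qed.
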